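(* Let $G$ be a connected graph on $n$ vertices whose edge weights are $s\times s$ positive definite matrices, and let $R$ be the resistance matrix of $G$. Then $$\sum_{i=1}^n\sum_{j\sim i}W_{i,j}^{-1}R_{j,i}=2(n-1)I_s.$$
   Context: $G$ is a simple connected graph with vertex set $\{1,\dots,n\}$; each edge $\{i,j\}$ carries a weight $W_{i,j}=W_{j,i}$, a real $s\times s$ positive definite matrix; $j\sim i$ means adjacency. The Laplacian $L$ is the $ns\times ns$ block matrix with $(i,i)$ block $\sum_{j\sim i}W_{i,j}^{-1}$, $(i,j)$ block ($i\ne j$) equal to $-W_{i,j}^{-1}$ if $i\sim j$ and $0$ otherwise. Writing $K_{i,j}$ for the $s\times s$ blocks of the Moore--Penrose inverse $L^\dagger$, the resistance matrix $R$ is the $ns\times ns$ block matrix with blocks $R_{i,j}=K_{i,i}+K_{j,j}-2K_{i,j}$. *)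

(* Defs.v *)
From mathcomp Require Import all_boot all_order all_algebra.

Set Implicit Arguments.
Unset Strict Implicit.
Unset Printing Implicit Defensive.

Import Order.TTheory GRing.Theory Num.Theory.
Local Open Scope ring_scope.

Section Defs.
Variable R : realFieldType.

(* Positive definite matrices are symmetric by convention. *)
Definition posdefmx (s : nat) (A : 'M[R]_s) : Prop :=
  A \is symmetricmx /\
  forall x : 'cV[R]_s, x != 0 -> 0 < (x^T *m A *m x) 0 0.

Definition is_mpinv (m n : nat) (A : 'M[R]_(m, n)) : pred 'M[R]_(n, m) :=
  fun X => [&& A *m X *m A == A, X *m A *m X == X,
               (A *m X)^T == A *m X & (X *m A)^T == X *m A].

Lemma gram_unitmx (r n : nat) (F : 'M[R]_(r, n)) :
  row_free F -> F *m F^T \in unitmx.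
Proof.
move=> freeF; rewrite -row_free_unit -kermx_eq0; apply/eqP/row_matrixP => i.
rewrite row0; set x := row i _.
have xFF : x *m (F *m F^T) = 0 by apply/sub_kermxP/row_sub.
suff xF0 : x *m F = 0 by apply: (row_free_inj freeF); rewrite xF0 mul0mx.
have sq0 : \sum_j (x *m F) 0 j ^+ 2 = 0.
  have /matrixP/(_ 0 0) : (x *m F) *m (x *m F)^T = 0.
    by rewrite trmx_mul mulmxA -(mulmxA x) xFF mul0mx.
  rewrite mxE [RHS]mxE => sum0; rewrite -[RHS]sum0; apply: eq_bigr => j _.
  by rewrite expr2 [_^T _ _]mxE.
apply/rowP => j; rewrite [RHS]mxE; apply/eqP.
by rewrite -sqrf_eq0 (psumr_eq0P _ sq0) // => k _; apply: sqr_ge0.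
Qed.

Lemma mpinv_exists (m n : nat) (A : 'M[R]_(m, n)) : exists X, is_mpinv A X.
Proof.
have: exists r (C : 'M[R]_(m, r)) (F : 'M[R]_(r, n)),
    [/\ A = C *m F, row_free F & row_full C].
  exists (\rank A), (col_base A), (row_base A).
  by rewrite mulmx_base row_base_free col_base_full.
case=> r [C [F [-> freeF fullC]]] {A}.
have uF : F *m F^T \in unitmx by apply: gram_unitmx.
have uC : C^T *m C \in unitmx.
  rewrite -{2}(trmxK C); apply: gram_unitmx.
  by rewrite /row_free mxrank_tr; apply: fullC.
set GF := invmx (F *m F^T); set GC := invmx (C^T *m C).
pose X := F^T *m GF *m GC *m C^T.
have GFT : GF^T = GF by rewrite /GF trmx_inv trmx_mul trmxK.
have GCT : GC^T = GC by rewrite /GC trmx_inv trmx_mul trmxK.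
have AX : C *m F *m X = C *m GC *m C^T.
  by rewrite /X !mulmxA -(mulmxA C F) -(mulmxA C) mulmxV // mulmx1.
have XA : X *m (C *m F) = F^T *m GF *m F.
  by rewrite /X !mulmxA -(mulmxA _ C^T C) -(mulmxA _ GC) mulVmx // mulmx1.
exists X; apply/and4P; split; apply/eqP.
- by rewrite AX !mulmxA -(mulmxA _ C^T C) -(mulmxA _ GC) mulVmx // mulmx1.
- by rewrite XA /X !mulmxA -(mulmxA _ F F^T) -(mulmxA _ GF (F *m F^T)) mulVmx // mulmx1.
- by rewrite AX !trmx_mul trmxK GCT mulmxA.
- by rewrite XA !trmx_mul trmxK GFT mulmxA.
Qed.

Lemma mpinv_uniq (m n : nat) (A : 'M[R]_(m, n)) (X Y : 'M[R]_(n, m)) :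
  is_mpinv A X -> is_mpinv A Y -> X = Y.
Proof.
case/and4P=> /eqP x1 /eqP x2 /eqP x3 /eqP x4.
case/and4P=> /eqP y1 /eqP y2 /eqP y3 /eqP y4.
have eAX : A *m X = A *m Y.
  by rewrite -x3 -{1}y1 -mulmxA trmx_mul x3 y3 mulmxA x1.
have eXA : X *m A = Y *m A.
  by rewrite -x4 -{1}y1 -mulmxA mulmxA trmx_mul x4 y4 -!mulmxA (mulmxA A) x1.
by rewrite -x2 eXA -mulmxA eAX mulmxA y2.
Qed.

Definition mpinv (m n : nat) (A : 'M[R]_(m, n)) : 'M[R]_(n, m) :=
  xchoose (mpinv_exists A).

Lemma mpinvP (m n : nat) (A : 'M[R]_(m, n)) : is_mpinv A (mpinv A).
Proof. exact: xchooseP. Qed.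

(* A graph on 'I_n is given by its adjacency relation adj; the values of W on
   non-adjacent pairs are never used. *)
Definition laplacian (n s : nat) (adj : rel 'I_n)
    (W : 'I_n -> 'I_n -> 'M[R]_s) : 'M[R]_(\sum_(i < n) s) :=
  \mxblock_(i < n, j < n)
    (if i == j then \sum_(k < n | adj k i) invmx (W i k)
     else if adj i j then - invmx (W i j) else 0).

Definition resistance (n s : nat) (adj : rel 'I_n)
    (W : 'I_n -> 'I_n -> 'M[R]_s) : 'M[R]_(\sum_(i < n) s) :=
  let K i j := submxblock (mpinv (laplacian adj W)) i j in
  \mxblock_(i < n, j < n) (K i i + K j j - K i j *+ 2).

End Defs.

(* Main.v *)
(* Splitting the blocks of the resistance matrix, the sum is twice
   [\sum_i \sum_(j ~ i) W_ij^-1 (K_ii - K_ji)], that is twice the sum of the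
   diagonal blocks of [L L^+].  Connectedness and positive definiteness make
   the kernel of [L] the constant block vectors, so [1 - L L^+] is the block
   averaging projection, with diagonal blocks [n^-1 I]. *)
Require Import Defs.
From mathcomp Require Import all_boot all_order all_algebra.
From mathcomp Require Import reals.

Set Implicit Arguments.
Unset Strict Implicit.
Unset Printing Implicit Defensive.

Import Order.TTheory GRing.Theory Num.Theory.
Local Open Scope ring_scope.

Section PosDef.
Variables (R : realFieldType) (s : nat).
Implicit Types A : 'M[R]_s.

Lemma posdefmx_tr A : posdefmx A -> A^T = A.
Proof. by case=> /is_hermitianmxP defA _; rewrite [RHS]defA expr0 scale1r map_mx_id. Qed.

Lemma posdefmx_unit A : posdefmx A -> A \in unitmx.
Proof.
move=> pdA; rewrite -row_free_unit -kermx_eq0; apply/eqP/row_matrixP => i.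
rewrite row0; set x := row i _; apply/eqP/negPn/negP => x_neq0.
have xA0 : x *m A = 0 by apply/sub_kermxP/row_sub.
have := pdA.2 x^T; rewrite trmx_eq0 x_neq0 trmxK xA0 mul0mx mxE ltxx.
by move/(_ isT).
Qed.

(** With [y = invmx A *m x], symmetry of [A] gives $y^T A y = x^T A^{-1} x$, and [y] is nonzero
    because [A] is invertible. *)
Lemma posdefmx_inv_gt0 A (x : 'cV[R]_s) :
  posdefmx A -> x != 0 -> 0 < (x^T *m invmx A *m x) 0 0.
Proof.
move=> pdA x_neq0; have uA := posdefmx_unit pdA.
have /pdA.2 : invmx A *m x != 0.
  apply: contraNneq x_neq0 => /(congr1 (mulmx A)).
  by rewrite mulKVmx // mulmx0 => ->.
by rewrite trmx_mul trmx_inv (posdefmx_tr pdA) -(mulmxA _ A) mulKVmx.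
Qed.

End PosDef.

Section Laplacian.
Variables (R : realFieldType) (n s : nat) (adj : rel 'I_n).
Variable W : 'I_n -> 'I_n -> 'M[R]_s.
Hypothesis adj_sym : symmetric adj.
Hypothesis adj_irr : irreflexive adj.
Hypothesis W_sym : forall i j, adj i j -> W i j = W j i.
Hypothesis W_posdef : forall i j, adj i j -> posdefmx (W i j).

Local Notation L := (laplacian adj W).

(** The diagonal block of [L] supplies one copy of [X i] per neighbour, which pairs with the
    off-diagonal terms. The width [m] is free so that this serves both for vectors and for the
    blocks of the pseudoinverse. *)
Lemma sum_laplacian_block m (i : 'I_n) (X : 'I_n -> 'M[R]_(s, m)) :
  \sum_j submxblock L i j *m X j =
  \sum_(j | adj j i) invmx (W i j) *m (X i - X j).
Proof.
rewrite (bigD1 i) //= mxblockK eqxx mulmx_suml.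
under [RHS]eq_bigr do rewrite mulmxBr.
rewrite sumrB; congr (_ + _).
rewrite (bigID (adj^~ i)) /= [X in _ + X]big1 ?addr0; last first.
  move=> j /andP[ji]; rewrite mxblockK eq_sym (negPf ji) adj_sym => /negPf ->.
  by rewrite mul0mx.
rewrite -sumrN; apply: eq_big => [j | j /andP[ji aji]].
  by rewrite andb_idl // => aji; apply: contraTneq aji => ->; rewrite adj_irr.
by rewrite mxblockK eq_sym (negPf ji) adj_sym aji mulNmx.
Qed.

Lemma tr_laplacian : L^T = L.
Proof.
rewrite tr_mxblock; apply: eq_mxblock => i j; rewrite eq_sym.
have trV k l : adj k l -> (invmx (W k l))^T = invmx (W k l).
  by move=> /W_posdef/posdefmx_tr trW; rewrite trmx_inv trW.
case: eqVneq => [-> | _].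
  rewrite raddf_sum /=; apply: eq_bigr => k; rewrite adj_sym; exact: trV.
rewrite adj_sym; case: ifP => [aij | _]; last exact: trmx0.
by rewrite raddfN /= trV ?(W_sym aij) // adj_sym.
Qed.

Lemma mul_laplacian_const : L *m \mxcol_(i < n) (1%:M : 'M[R]_s) = 0.
Proof.
rewrite -(submxblockK L) mul_mxblock_mxrow.
apply/mxcolP => i; rewrite mxcolK submxcol0 sum_laplacian_block big1 // => j _.
by rewrite subrr mulmx0.
Qed.

(* Summing [x_i^T (L x)_i] over i, the two orientations of each edge combine
   into the energy [(x_i - x_j)^T W_ij^-1 (x_i - x_j)]. *)
Lemma laplacian_energy (x : 'I_n -> 'cV[R]_s) :
  \sum_i (x i)^T *m (\sum_j submxblock L i j *m x j) *+ 2 =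
  \sum_i \sum_(j | adj j i)
     (x i - x j)^T *m invmx (W i j) *m (x i - x j).
Proof.
rewrite sumrMnl.
under eq_bigr do rewrite sum_laplacian_block mulmx_sumr.
rewrite mulr2n.
have swap : \sum_i \sum_(j | adj j i) (x i)^T *m (invmx (W i j) *m (x i - x j))
  = - \sum_i \sum_(j | adj j i) (x j)^T *m (invmx (W i j) *m (x i - x j)).
  rewrite (exchange_big_dep xpredT) //= -sumrN; apply: eq_bigr => i _.
  rewrite -sumrN; apply: eq_big => [j | j aij]; first exact: adj_sym.
  by rewrite (W_sym aij) -[x j - x i]opprB !mulmxN.
rewrite [X in _ + X]swap -sumrB; apply: eq_bigr => i _.
rewrite -sumrB; apply: eq_bigr => j _.
by rewrite -mulmxBl -[_^T - _]raddfB mulmxA.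
Qed.

(** A kernel vector has zero energy. The energy is a sum of nonnegative edge terms, so each
    vanishes, and definiteness of $W_{ij}^{-1}$ forces the difference across the edge to be zero. *)
Lemma laplacian_ker_edge (x : 'cV[R]_(\sum_(i < n) s)) (i j : 'I_n) :
  L *m x = 0 -> adj i j -> submxcol x i = submxcol x j.
Proof.
move=> Lx0 aij; set y := submxcol x.
have Ly0 k : \sum_l submxblock L k l *m y l = 0.
  rewrite -(mxcolK (fun k => \sum_l submxblock L k l *m y l) k).
  by rewrite -mul_mxblock_mxrow submxblockK submxcolK Lx0 submxcol0.
pose e k l := ((y k - y l)^T *m invmx (W k l) *m (y k - y l)) 0 0.
have e_ge0 k l : adj l k -> 0 <= e k l.
  rewrite adj_sym => akl; rewrite /e.
  have [-> | ne0] := eqVneq (y k - y l) 0; first by rewrite mulmx0 mxE.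
  exact/ltW/posdefmx_inv_gt0/ne0/W_posdef.
have sum_e0 : \sum_k \sum_(l | adj l k) e k l = 0.
  transitivity ((\sum_k \sum_(l | adj l k)
     (y k - y l)^T *m invmx (W k l) *m (y k - y l)) 0 0).
    by rewrite summxE; apply: eq_bigr => k _; rewrite summxE.
  rewrite -laplacian_energy big1 ?mxE // => k _.
  by rewrite Ly0 mulmx0 mul0rn.
have ei0 : \sum_(l | adj l i) e i l = 0.
  by apply: (psumr_eq0P _ sum_e0) => // k _; apply: sumr_ge0 => l /e_ge0.
have eij0 : e i j = 0.
  by apply: (psumr_eq0P (e_ge0 i) ei0); rewrite adj_sym.
apply/eqP; rewrite -subr_eq0; apply/negPn/negP => ne0.
by have := posdefmx_inv_gt0 (W_posdef aij) ne0; rewrite -/(e i j) eij0 ltxx.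
Qed.

Hypothesis adj_conn : forall i j, connect adj i j.

(** Equality across an edge holds column by column, and propagates along a path from [i] to [j]. *)
Lemma laplacian_ker m (Z : 'M[R]_(\sum_(i < n) s, m)) (i j : 'I_n) :
  L *m Z = 0 -> submxcol Z i = submxcol Z j.
Proof.
move=> LZ0.
have edge k l : adj k l -> submxcol Z k = submxcol Z l.
  move=> akl; apply/matrixP => a b.
  have Lb0 : L *m col b Z = 0 by rewrite colE mulmxA LZ0 mul0mx.
  by move/colP/(_ a): (laplacian_ker_edge Lb0 akl); rewrite !mxE.
have /connectP[p] := adj_conn i j.
by elim: p i => [i _ -> | k p IHp i /= /andP[/edge -> /IHp]].
Qed.

(* The columns of [Y = 1 - L L^+] lie in the kernel of [L], so the blocks of
   each block column of [Y] coincide; since [L] kills constant vectors, they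
   sum to the identity. *)
Lemma mpinv_laplacian_block (i : 'I_n) :
  submxblock (1%:M - L *m mpinv L) i i = n%:R^-1 *: 1%:M.
Proof.
case/and4P: (mpinvP L) => /eqP LKL _ /eqP trLK _.
set Y := _ - _.
have trY : Y^T = Y by rewrite raddfB /= trmx1 trLK.
(* The Penrose identity $L L^+ L = L$ gives $Y L = 0$; transposing reverses the order, as [L] and
   [Y] are symmetric. *)
have LY0 : L *m Y = 0.
  apply: trmx_inj; rewrite trmx_mul trY tr_laplacian trmx0.
  by rewrite mulmxBl mul1mx LKL subrr.
have Yconst k : submxblock Y k i = submxblock Y i i.
  by rewrite !submxblockEv (laplacian_ker k i LY0).
have sumY : \sum_k submxblock Y k i = 1%:M.
  (* Left multiplication by the row of identity blocks sums each block column, and this row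
     annihilates [L] by symmetry. *)
  have : \mxrow_(k < n) (1%:M : 'M[R]_s) *m Y = \mxrow_(k < n) 1%:M.
    rewrite mulmxBr mulmx1 mulmxA -[\mxrow_(_ < _) _ *m L]trmxK trmx_mul.
    rewrite tr_laplacian tr_mxrow.
    under eq_mxcol do rewrite trmx1.
    by rewrite mul_laplacian_const trmx0 mul0mx subr0.
  rewrite -{1}(submxblockK Y) mul_mxrow_mxblock => /eq_mxrowP/(_ i) <-.
  by apply: eq_bigr => k _; rewrite mul1mx.
rewrite -sumY (eq_bigr _ (fun k _ => Yconst k)) sumr_const card_ord.
rewrite -[X in _ *: X]scaler_nat scalerA mulVf ?scale1r //.
(* The index [i] itself witnesses that [n] is positive. *)
by rewrite pnatr_eq0 -lt0n (leq_ltn_trans _ (ltn_ord i)).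
Qed.

End Laplacian.

Theorem theorem3p5 (R : realType) (n s : nat) (adj : rel 'I_n)
    (W : 'I_n -> 'I_n -> 'M[R]_s)
    (n_gt0 : (0 < n)%N)
    (adj_sym : symmetric adj)
    (adj_irr : irreflexive adj)
    (adj_conn : forall i j : 'I_n, connect adj i j)
    (W_sym : forall i j : 'I_n, adj i j -> W i j = W j i)
    (W_posdef : forall i j : 'I_n, adj i j -> posdefmx (W i j)) :
  \sum_(i < n) \sum_(j < n | adj j i)
      (invmx (W i j) *m submxblock (resistance adj W) j i)
  = (2 * (n%:R - 1))%:M :> 'M[R]_s.
Proof.
set L := laplacian adj W; pose K i j := submxblock (mpinv L) i j.
have -> : \sum_i \sum_(j | adj j i)
    invmx (W i j) *m submxblock (resistance adj W) j i =
  \sum_i (submxblock (L *m mpinv L) i i) *+ 2.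
  have LK i : submxblock (L *m mpinv L) i i =
      \sum_(j | adj j i) invmx (W i j) *m (K i i - K j i).
    rewrite -(sum_laplacian_block W adj_sym adj_irr i (K^~ i)).
    rewrite -{1}(submxblockK L) -{1}(submxblockK (mpinv L)) mul_mxblock.
    exact: mxblockK.
  (* Exchanging the endpoints of every edge preserves its weight, so the two diagonal contributions
     to $R_{j,i}$ have the same total. *)
  have swap : \sum_i \sum_(j | adj j i) invmx (W i j) *m K j j =
      \sum_i \sum_(j | adj j i) invmx (W i j) *m K i i.
    rewrite (exchange_big_dep xpredT) //=; apply: eq_bigr => i _.
    by apply: eq_big => [j | j aij]; rewrite ?(W_sym _ _ aij) // adj_sym.
  transitivity (\sum_i \sum_(j | adj j i)
     (invmx (W i j) *m K i i *+ 2 - invmx (W i j) *m K j i *+ 2)).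
    under [RHS]eq_bigr do rewrite sumrB.
    rewrite sumrB.
    under [X in _ = X - _]eq_bigr do rewrite sumrMnl.
    rewrite sumrMnl mulr2n -{1}swap -big_split -sumrB /=.
    apply: eq_bigr => i _; rewrite -big_split -sumrB /=.
    apply: eq_bigr => j _.
    by rewrite mxblockK -/L !mulr2n mulmxBr !mulmxDr.
  apply: eq_bigr => i _; rewrite LK -sumrMnl; apply: eq_bigr => j _.
  by rewrite mulmxBr mulrnBl.
have LKii i : submxblock (L *m mpinv L) i i = (1 - n%:R^-1)%:M.
  rewrite -[L *m mpinv L](subKr 1%:M) submxblockB.
  rewrite (mpinv_laplacian_block adj_sym adj_irr W_sym W_posdef adj_conn).
  by rewrite -mxdiagZ submxblock_diag scalemx1 -raddfB.
under eq_bigr do rewrite LKii.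
rewrite sumr_const card_ord -!scaler_nat !scale_scalar_mx; congr _%:M.
(* The $n$ equal blocks give $n(1 - n^{-1}) = n - 1$, as $n \neq 0$. *)
by rewrite mulrCA mulrBr mulr1 mulfV // pnatr_eq0 -lt0n.
Qed.
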